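(* Let $K$ be a field, $\lambda\in K$, and let $(A,\mu,1,\alpha,\beta)$ be a unitary BiHom-associative algebra over $K$ with $\alpha,\beta$ bijective. Let $\psi,\omega:A\to A$ be linear maps such that any two of $\alpha,\beta,\psi,\omega$ commute, $\psi(ab)=\psi(a)\psi(b)$, $\omega(ab)=\omega(a)\omega(b)$ for all $a,b\in A$, and $\psi(1)=1=\omega(1)$. Let $r=r^1\otimes r^2\in A\otimes A$ satisfy $(f\otimes f)(r)=r$ for each $f\in\{\alpha,\beta,\psi,\omega\}$. Then the linear map $\widetilde{\Delta}_r:A\to A\otimes A$, $$\widetilde{\Delta}_r(a)=\omega\alpha^{-1}(a)r^1\otimes\beta(r^2)-\alpha(r^1)\otimes r^2\,\psi\beta^{-1}(a)-\lambda(1\otimes\psi(a)),$$ is a $\lambda$-BiHom-derivation.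
   Context: A BiHom-associative algebra $(A,\mu,\alpha,\beta)$ consists of a vector space $A$ and linear maps $\mu:A\otimes A\to A$ (written $ab$), $\alpha,\beta:A\to A$ with $\alpha\beta=\beta\alpha$, $\alpha(ab)=\alpha(a)\alpha(b)$, $\beta(ab)=\beta(a)\beta(b)$ and $\alpha(a)(bc)=(ab)\beta(c)$. It is unitary with unit $1$ if $\alpha(1)=1=\beta(1)$, $a1=\alpha(a)$, $1a=\beta(a)$ for all $a$. The notation $r=r^1\otimes r^2$ means a (suppressed) finite sum. With $\psi,\omega$ commuting with $\alpha,\beta$, a linear map $\delta:A\to A\otimes A$, $\delta(a)=a_{[1]}\otimes a_{[2]}$, is a $\lambda$-BiHom-derivation if $(f\otimes f)\circ\delta=\delta\circ f$ for $f\in\{\alpha,\beta,\psi,\omega\}$ and, for all $a,b\in A$, $$\delta(ab)=\omega(a)b_{[1]}\otimes\beta(b_{[2]})+\alpha(a_{[1]})\otimes a_{[2]}\psi(b)+\lambda\,\alpha\omega(a)\otimes\beta\psi(b).$$ *)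

(* Defs.v *)
From HB Require Import structures.
From mathcomp Require Import all_boot all_order all_algebra.
From mathcomp Require Import sesquilinear ring_quotient.
From mathcomp Require Import boolp.
From mathcomp Require Import freeg.

Set Implicit Arguments.
Unset Strict Implicit.
Unset Printing Implicit Defensive.

Import GRing.Theory.
Local Open Scope ring_scope.
Local Open Scope quotient_scope.

Lemma fglift_is_linear (R : nzRingType) (M : lmodType R) (T : choiceType)
  (f : T -> M) : linear (fglift f).
Proof.
pose F : {additive {freeg T / R} -> M} :=
  HB.pack (fglift f) (GRing.isZmodMorphism.Build _ _ _ (lift_is_additive f)).
have FZ c D : F (c *: D) = c *: F D.
  rewrite -[in RHS](freeg_sumE D) -[c *: D]/(fgscale c D) !raddf_sum.
  by apply: eq_bigr => x _ /=; rewrite !liftU scalerA.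
by move=> c x y; have := raddfD F (c *: x) y; rewrite FZ.
Qed.

HB.instance Definition _ (R : nzRingType) (M : lmodType R) (T : choiceType)
  (f : T -> M) :=
  GRing.isLinear.Build R {freeg T / R} M *:%R (fglift f) (fglift_is_linear f).

(* U \otimes V is the free module on U * V modulo the submodule spanned by the
   bilinearity relations. *)
Section Tensor.
Context (K : fieldType) (U V : lmodType K).

Inductive tensor_rel : {freeg (U * V) / K} -> Prop :=
| tensor_rel0 : tensor_rel 0
| tensor_relP c x y : tensor_rel x -> tensor_rel y -> tensor_rel (c *: x + y)
| tensor_rel_left c u u' v :
    tensor_rel (<< (c *: u + u', v) >> - (c *: << (u, v) >> + << (u', v) >>))
| tensor_rel_right c u v v' :
    tensor_rel (<< (u, c *: v + v') >> - (c *: << (u, v) >> + << (u, v') >>)).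

Definition tensor_relb : {pred {freeg (U * V) / K}} := fun x => `[< tensor_rel x >].

Lemma tensor_relZ c x : x \in tensor_relb -> c *: x \in tensor_relb.
Proof.
move=> /asboolP hx; apply/asboolP; rewrite -[_ *: _]addr0.
exact: tensor_relP hx tensor_rel0.
Qed.

Lemma tensor_rel_zmod_closed : zmod_closed tensor_relb.
Proof.
split=> [|x y /asboolP hx /asboolP hy]; apply/asboolP; first exact: tensor_rel0.
by rewrite addrC -scaleN1r; apply: tensor_relP.
Qed.

HB.instance Definition _ :=
  GRing.isZmodClosed.Build _ tensor_relb tensor_rel_zmod_closed.

Definition tensor := Quotient.quot tensor_relb.

HB.instance Definition _ := GRing.Zmodule.on tensor.

Definition tensor_pi (x : {freeg (U * V) / K}) : tensor := \pi x.

Lemma tensor_pi_is_zmod_morphism : zmod_morphism tensor_pi.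
Proof. by move=> x y; rewrite /tensor_pi !piE. Qed.

HB.instance Definition _ :=
  GRing.isZmodMorphism.Build _ _ tensor_pi tensor_pi_is_zmod_morphism.

Lemma tensor_piP x y : (tensor_pi x == tensor_pi y) = (x - y \in tensor_relb).
Proof. by rewrite /tensor_pi Quotient.idealrBE. Qed.

Lemma tensor_pi_repr (t : tensor) : tensor_pi (repr t) = t.
Proof. exact: reprK. Qed.

Definition tensor_scale (c : K) (t : tensor) : tensor := tensor_pi (c *: repr t).

Lemma tensor_piZ c x : tensor_pi (c *: x) = tensor_scale c (tensor_pi x).
Proof.
apply/eqP; rewrite tensor_piP -scalerBr; apply: tensor_relZ.
by rewrite -tensor_piP tensor_pi_repr.
Qed.

Lemma tensor_scaleA a b t :
  tensor_scale a (tensor_scale b t) = tensor_scale (a * b) t.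
Proof. by rewrite -[t]tensor_pi_repr -!tensor_piZ scalerA. Qed.

Lemma tensor_scale1 : left_id 1 tensor_scale.
Proof. by move=> t; rewrite -[t]tensor_pi_repr -tensor_piZ scale1r. Qed.

Lemma tensor_scaleDr : right_distributive tensor_scale +%R.
Proof.
move=> a t t'; rewrite -[t]tensor_pi_repr -[t']tensor_pi_repr.
by rewrite -raddfD -!tensor_piZ -raddfD scalerDr.
Qed.

Lemma tensor_scaleDl t : {morph tensor_scale^~ t : a b / a + b}.
Proof.
by move=> a b; rewrite -[t]tensor_pi_repr -!tensor_piZ -raddfD scalerDl.
Qed.

HB.instance Definition _ := GRing.Zmodule_isLmodule.Build K tensor
  tensor_scaleA tensor_scale1 tensor_scaleDr tensor_scaleDl.

Lemma tensor_pi_is_scalable : scalable tensor_pi.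
Proof. exact: tensor_piZ. Qed.

HB.instance Definition _ :=
  GRing.isScalable.Build _ _ _ _ tensor_pi tensor_pi_is_scalable.

Definition tens (u : U) (v : V) : tensor := tensor_pi << (u, v) >>.

Lemma tens_is_bilinear : bilinear_for
  (GRing.Scale.Law.clone _ _ *:%R _) (GRing.Scale.Law.clone _ _ *:%R _) tens.
Proof.
by split=> [v|u] c x y; rewrite /tens -linearZ -raddfD; apply/eqP;
  rewrite tensor_piP; apply/asboolP; constructor.
Qed.

HB.instance Definition _ :=
  bilinear_isBilinear.Build K U V tensor _ _ tens tens_is_bilinear.

Lemma tensor_ind (P : tensor -> Prop) :
  (forall u v, P (tens u v)) ->
  (forall c x y, P x -> P y -> P (c *: x + y)) -> forall t, P t.
Proof.
move=> Ptens PD t; have P0 : P 0.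
  by have := PD (-1) _ _ (Ptens 0 0) (Ptens 0 0); rewrite scaleN1r addNr.
rewrite -[t]tensor_pi_repr -(freeg_sumE (repr t)) raddf_sum.
elim: (dom _) => [|[u v] s IHs]; first by rewrite big_nil.
rewrite big_cons; set c := coeff _ _.
have -> : << c *g (u, v) >> = c *: << (u, v) >> :> {freeg (U * V) / K}.
  by apply/eqP/freeg_eqP => z; rewrite coeffZ !coeffU mul1r.
by rewrite /= tensor_piZ; apply: PD; [exact: Ptens | exact: IHs].
Qed.

Section Lift.
Context (W : lmodType K) (f : {bilinear U -> V -> W}).

Definition tensor_lift (t : tensor) : W := fglift (fun p => f p.1 p.2) (repr t).

Lemma tensor_lift_pi x : tensor_lift (tensor_pi x) = fglift (fun p => f p.1 p.2) x.
Proof.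
pose F : {linear {freeg (U * V) / K} -> W} := fglift (fun p => f p.1 p.2).
suff F0 y : tensor_rel y -> F y = 0.
  have /asboolP/F0 : repr (tensor_pi x) - x \in tensor_relb.
    by rewrite -tensor_piP tensor_pi_repr.
  by rewrite linearB => /eqP; rewrite subr_eq0 => /eqP.
elim=> [|c y1 y2 _ Fy1 _ Fy2|c u u' v|c u v v'].
- by rewrite linear0.
- by rewrite linearP Fy1 Fy2 scaler0 addr0.
- by rewrite linearB linearD linearZ /= !liftU !scale1r /= linearPl subrr.
- by rewrite linearB linearD linearZ /= !liftU !scale1r /= linearPr subrr.
Qed.

Lemma tensor_lift_is_linear : linear tensor_lift.
Proof.
move=> c x y; rewrite -[x]tensor_pi_repr -[y]tensor_pi_repr -linearP.
by rewrite !tensor_lift_pi linearP.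
Qed.

HB.instance Definition _ :=
  GRing.isLinear.Build _ _ _ _ tensor_lift tensor_lift_is_linear.

Lemma tensor_liftE u v : tensor_lift (tens u v) = f u v.
Proof. by rewrite tensor_lift_pi liftU scale1r. Qed.

Lemma tensor_lift_unique (g : {linear tensor -> W}) :
  (forall u v, g (tens u v) = f u v) -> g =1 tensor_lift.
Proof.
move=> gE; elim/tensor_ind => [u v|c x y IHx IHy]; first by rewrite tensor_liftE.
by rewrite !linearP IHx IHy.
Qed.

End Lift.
End Tensor.

Notation "U \otimes V" := (tensor U V)
  (at level 40, left associativity) : type_scope.
Notation "u \otimes v" := (tens u v)
  (at level 40, left associativity) : ring_scope.

Section TensorMap.
Context (K : fieldType) (U U' V V' : lmodType K).
Context (f : {linear U -> U'}) (g : {linear V -> V'}).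

Definition tensor_map_pure (u : U) (v : V) : (U' \otimes V')%type :=
  f u \otimes g v.

Lemma tensor_map_pure_is_bilinear : bilinear_for
  (GRing.Scale.Law.clone _ _ *:%R _) (GRing.Scale.Law.clone _ _ *:%R _)
  tensor_map_pure.
Proof.
by split=> [v|u] c x y; rewrite /tensor_map_pure linearP ?linearPl ?linearPr.
Qed.

HB.instance Definition _ := bilinear_isBilinear.Build K U V
  (U' \otimes V')%type _ _ tensor_map_pure tensor_map_pure_is_bilinear.

Definition tensor_map : {linear (U \otimes V)%type -> (U' \otimes V')%type} :=
  tensor_lift tensor_map_pure.

Lemma tensor_mapE u v : tensor_map (u \otimes v) = f u \otimes g v.
Proof. exact: tensor_liftE. Qed.

End TensorMap.

Section BijInv.
Context (T1 T2 : Type) (f : T1 -> T2) (bij_f : bijective f).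

Lemma bij_inv_exists : exists g, cancel f g /\ cancel g f.
Proof. by case: bij_f => g; exists g. Qed.

Definition bij_inv : T2 -> T1 := sval (cid bij_inv_exists).

Lemma bij_invK : cancel f bij_inv.
Proof. by rewrite /bij_inv; case: cid => g []. Qed.

Lemma bij_invKV : cancel bij_inv f.
Proof. by rewrite /bij_inv; case: cid => g []. Qed.

End BijInv.

Definition commuting (T : Type) (f g : T -> T) : Prop :=
  forall x, f (g x) = g (f x).

Section BiHom.
Context (K : fieldType) (A : lmodType K) (mu : {linear (A \otimes A)%type -> A}).

Definition lmul (a : A) : A -> A := fun x => mu (a \otimes x).
Definition rmul (a : A) : A -> A := fun x => mu (x \otimes a).

Lemma lmul_is_linear a : linear (lmul a).
Proof. by move=> c x y; rewrite /lmul linearPr linearP. Qed.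

Lemma rmul_is_linear a : linear (rmul a).
Proof. by move=> c x y; rewrite /rmul linearPl linearP. Qed.

HB.instance Definition _ a :=
  GRing.isLinear.Build _ _ _ _ (lmul a) (lmul_is_linear a).
HB.instance Definition _ a :=
  GRing.isLinear.Build _ _ _ _ (rmul a) (rmul_is_linear a).

Definition multiplicative_for (f : A -> A) : Prop :=
  forall a b, f (mu (a \otimes b)) = mu (f a \otimes f b).

Record bihom_associative (alpha beta : {linear A -> A}) : Prop := {
  bihom_comm : commuting alpha beta;
  bihom_alphaM : multiplicative_for alpha;
  bihom_betaM : multiplicative_for beta;
  bihom_assoc : forall a b c,
    mu (alpha a \otimes mu (b \otimes c)) = mu (mu (a \otimes b) \otimes beta c)
}.

Record unitary_bihom_associative (one : A) (alpha beta : {linear A -> A}) : Prop := {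
  unitary_bihom_assoc :> bihom_associative alpha beta;
  bihom_alpha1 : alpha one = one;
  bihom_beta1 : beta one = one;
  bihom_mulr1 : forall a, mu (a \otimes one) = alpha a;
  bihom_mul1r : forall a, mu (one \otimes a) = beta a
}.

Record bihom_derivation (lambda : K) (alpha beta psi omega : {linear A -> A})
    (delta : A -> (A \otimes A)%type) : Prop := {
  bihom_der_linear : linear delta;
  bihom_der_alpha : forall a, tensor_map alpha alpha (delta a) = delta (alpha a);
  bihom_der_beta : forall a, tensor_map beta beta (delta a) = delta (beta a);
  bihom_der_psi : forall a, tensor_map psi psi (delta a) = delta (psi a);
  bihom_der_omega : forall a, tensor_map omega omega (delta a) = delta (omega a);
  (* omega(a) b_[1] (x) beta(b_[2]) is the image of delta b under the linear map
     x (x) y |-> omega(a) x (x) beta(y), and likewise for the second term. *)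
  bihom_der_mul : forall a b,
    delta (mu (a \otimes b)) =
      tensor_map (lmul (omega a)) beta (delta b)
      + tensor_map alpha (rmul (psi b)) (delta a)
      + lambda *: (alpha (omega a) \otimes beta (psi b))
}.

Definition tilde_Delta (lambda : K) (one : A) (alpha beta psi omega : {linear A -> A})
    (bij_alpha : bijective alpha) (bij_beta : bijective beta)
    (r : (A \otimes A)%type) (a : A) : (A \otimes A)%type :=
  tensor_map (lmul (omega (bij_inv bij_alpha a))) beta r
  - tensor_map alpha (rmul (psi (bij_inv bij_beta a))) r
  - lambda *: (one \otimes psi a).

End BiHom.

(* Main.v *)
Require Import Defs.
From mathcomp Require Import all_boot all_order all_algebra.

(** Expand both sides of the Leibniz rule.  Since [omega a = alpha (omega (alpha^-1 a))]
   and [psi b = beta (psi (beta^-1 b))], BiHom-associativity regroups the two terms in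
   which [a] and [b] fall on the same side of [r] into those of [Delta (a b)], up to an
   application of [beta \otimes beta] or [alpha \otimes alpha] to [r], which is absorbed
   by invariance.  The two mixed terms [omega(a) alpha(r^1) \otimes beta(r^2) psi(b)]
   cancel, and the [lambda]-term of [Delta b] cancels the weight
   [lambda alpha omega(a) \otimes beta psi(b)] because [omega(a) 1 = alpha (omega a)]. *)

Import GRing.Theory.
Local Open Scope ring_scope.

Section TensorMapTheory.
Context (K : fieldType).

(** Both sides are linear in [t], so pure tensors suffice. This reduces every identity between
    images of [r] to one identity in [A] per tensor leg, without choosing a decomposition of [r]. *)
Lemma eq_tensor_map_comp (U V U1 V1 U2 V2 W X : lmodType K)
    (f1 : {linear U -> U1}) (g1 : {linear V -> V1})
    (f1' : {linear U1 -> W}) (g1' : {linear V1 -> X})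
    (f2 : {linear U -> U2}) (g2 : {linear V -> V2})
    (f2' : {linear U2 -> W}) (g2' : {linear V2 -> X}) :
  f1' \o f1 =1 f2' \o f2 -> g1' \o g1 =1 g2' \o g2 ->
  forall t, tensor_map f1' g1' (tensor_map f1 g1 t)
    = tensor_map f2' g2' (tensor_map f2 g2 t).
Proof.
move=> ef eg; elim/tensor_ind => [u v|c x y IHx IHy]; last first.
  by rewrite !linearP IHx IHy.
by rewrite !tensor_mapE; congr (_ \otimes _); [exact: ef | exact: eg].
Qed.

Lemma scalerD_ACA (V : lmodType K) (c d : K) (x1 x2 y1 y2 : V) :
  d *: (c *: x1 + x2) + (c *: y1 + y2) = c *: (d *: x1 + y1) + (d *: x2 + y2).
Proof. by rewrite !scalerDr !scalerA mulrC addrACA. Qed.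

Context (U V U' V' : lmodType K).

(** In [tilde_Delta] the argument [a] enters through a multiplication operator, so linearity in [a]
    needs linearity of [tensor_map] in the map itself. *)
Lemma tensor_mapPl c (f f1 f2 : {linear U -> U'}) (g : {linear V -> V'}) t :
  (forall u, f u = c *: f1 u + f2 u) ->
  tensor_map f g t = c *: tensor_map f1 g t + tensor_map f2 g t.
Proof.
move=> ef; elim/tensor_ind: t => [u v|d x y IHx IHy].
  by rewrite !tensor_mapE ef linearPl.
by rewrite !(linearP (tensor_map _ _)) IHx IHy scalerD_ACA.
Qed.

Lemma tensor_mapPr c (f : {linear U -> U'}) (g g1 g2 : {linear V -> V'}) t :
  (forall v, g v = c *: g1 v + g2 v) ->
  tensor_map f g t = c *: tensor_map f g1 t + tensor_map f g2 t.
Proof.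
move=> eg; elim/tensor_ind: t => [u v|d x y IHx IHy].
  by rewrite !tensor_mapE eg linearPr.
by rewrite !(linearP (tensor_map _ _)) IHx IHy scalerD_ACA.
Qed.

End TensorMapTheory.

Lemma bij_inv_linear (K : fieldType) (U V : lmodType K) (f : {linear U -> V})
  (bij_f : bijective f) : linear (bij_inv bij_f).
Proof. exact: can2_linear (bij_invK bij_f) (bij_invKV bij_f). Qed.

Lemma bij_inv_commuting (T : Type) (f g : T -> T) (bij_f : bijective f) :
  commuting f g -> commuting (bij_inv bij_f) g.
Proof.
move=> fg x; apply: (can_inj (bij_invK bij_f)).
by rewrite bij_invKV fg bij_invKV.
Qed.

Lemma bij_inv_multiplicative (K : fieldType) (A : lmodType K)
    (mu : {linear (A \otimes A)%type -> A}) (f : A -> A) (bij_f : bijective f) :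
  multiplicative_for mu f -> multiplicative_for mu (bij_inv bij_f).
Proof.
move=> fM a b; apply: (can_inj (bij_invK bij_f)).
by rewrite fM !bij_invKV.
Qed.

Section TildeDelta.
Context (K : fieldType) (lambda : K) (A : lmodType K).
Context (mu : {linear (A \otimes A)%type -> A}) (one : A).
Context (alpha beta psi omega : {linear A -> A}).
Context (bij_alpha : bijective alpha) (bij_beta : bijective beta).
Context (r : (A \otimes A)%type).

Let D := tilde_Delta mu lambda one psi omega bij_alpha bij_beta r.

Lemma tilde_Delta_linear : linear D.
Proof.
move=> c a b; rewrite /D /tilde_Delta.
rewrite (tensor_mapPl _ _ _ _ _ c _ (lmul mu (omega (bij_inv bij_alpha a)))
          (lmul mu (omega (bij_inv bij_alpha b)))); last first.
  by move=> u; rewrite /= /lmul bij_inv_linear !linearP linearPl linearP.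
rewrite (tensor_mapPr _ _ _ _ _ c alpha _ (rmul mu (psi (bij_inv bij_beta a)))
          (rmul mu (psi (bij_inv bij_beta b)))); last first.
  by move=> u; rewrite /= /rmul bij_inv_linear !linearP linearPr linearP.
rewrite [psi (c *: a + b)]linearP linearPr scalerDr !scalerBr !scalerA mulrC.
by rewrite !opprD [RHS]addrACA; congr (_ + _); rewrite addrACA.
Qed.

Lemma tensor_map_tilde_Delta (f g : {linear A -> A}) a :
  tensor_map f g (D a) =
    tensor_map f g (tensor_map (lmul mu (omega (bij_inv bij_alpha a))) beta r)
    - tensor_map f g (tensor_map alpha (rmul mu (psi (bij_inv bij_beta a))) r)
    - lambda *: (f one \otimes g (psi a)).
Proof.
rewrite /D /tilde_Delta !(linearB (tensor_map f g)) linearZ_LR.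
by rewrite tensor_mapE.
Qed.

(** A multiplicative [f] moves past [lmul mu x] and [rmul mu x] at the cost of replacing [x] by
    [f x]. What remains is [f \otimes f] applied to [r], which invariance absorbs; the [lambda]-term
    only needs [f one = one]. *)
Lemma tilde_Delta_equivariant (f : {linear A -> A}) :
  commuting alpha f -> commuting beta f -> commuting psi f ->
  commuting omega f -> multiplicative_for mu f -> f one = one ->
  tensor_map f f r = r ->
  forall a, tensor_map f f (D a) = D (f a).
Proof.
move=> af bf pf wf fM f1 fr a; rewrite tensor_map_tilde_Delta f1 -pf.
rewrite /D /tilde_Delta -[in RHS]fr; congr (_ - _ - _).
- apply: eq_tensor_map_comp => x /=; last by rewrite bf.
  by rewrite /lmul fM (bij_inv_commuting _ _ _ bij_alpha af) wf.
- apply: eq_tensor_map_comp => x /=; first by rewrite af.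
  by rewrite /rmul fM (bij_inv_commuting _ _ _ bij_beta bf) pf.
Qed.

Lemma tilde_Delta_Leibniz :
  unitary_bihom_associative mu one alpha beta ->
  commuting alpha omega -> commuting beta psi ->
  multiplicative_for mu psi -> multiplicative_for mu omega ->
  tensor_map alpha alpha r = r -> tensor_map beta beta r = r ->
  forall a b, D (mu (a \otimes b)) =
    tensor_map (lmul mu (omega a)) beta (D b)
    + tensor_map alpha (rmul mu (psi b)) (D a)
    + lambda *: (alpha (omega a) \otimes beta (psi b)).
Proof.
move=> hA aw bp psiM omegaM ra rb a b.
have [[_ alphaM betaM assoc] alpha1 _ mulr1 _] := hA.
have alphaVM := bij_inv_multiplicative _ _ _ _ bij_alpha alphaM.
have betaVM := bij_inv_multiplicative _ _ _ _ bij_beta betaM.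
(* BiHom-associativity needs an outer left factor in the image of [alpha], or an outer right factor
   in the image of [beta]. *)
have omegaE x : omega x = alpha (omega (bij_inv bij_alpha x)).
  by rewrite aw bij_invKV.
have psiE x : psi x = beta (psi (bij_inv bij_beta x)).
  by rewrite bp bij_invKV.
rewrite !tensor_map_tilde_Delta alpha1 /D /tilde_Delta.
rewrite (mulr1 (omega a) : (lmul mu (omega a) : {linear A -> A}) one = _) psiM.
(* The [lambda]-term of [D (a b)] now has the same form as the one coming from [D a]. *)
rewrite -[mu (psi a \otimes _)]/((rmul mu (psi b) : {linear A -> A}) (psi a)).
rewrite (_ : tensor_map (lmul mu (omega a)) beta
      (tensor_map (lmul mu (omega (bij_inv bij_alpha b))) beta r) =
    tensor_map (lmul mu (omega (bij_inv bij_alpha (mu (a \otimes b))))) beta r);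
  last first.
  (* In the left leg, with [a' = alpha^-1 a] and [b' = alpha^-1 b]: [alpha (omega a') (omega b' x) =
     (omega a' omega b') beta x]. *)
  rewrite -[in RHS]rb; apply: eq_tensor_map_comp => x //=.
  by rewrite /lmul omegaE assoc alphaVM omegaM.
rewrite (_ : tensor_map alpha (rmul mu (psi b))
      (tensor_map alpha (rmul mu (psi (bij_inv bij_beta a))) r) =
    tensor_map alpha (rmul mu (psi (bij_inv bij_beta (mu (a \otimes b))))) r);
  last first.
  (* In the right leg, with [a' = beta^-1 a] and [b' = beta^-1 b]: [(x psi a') beta (psi b') = alpha
     x (psi a' psi b')]. *)
  rewrite -[in RHS]ra; apply: eq_tensor_map_comp => x //=.
  by rewrite /rmul (psiE b) -assoc betaVM psiM.
rewrite (_ : tensor_map (lmul mu (omega a)) beta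
      (tensor_map alpha (rmul mu (psi (bij_inv bij_beta b))) r) =
    tensor_map alpha (rmul mu (psi b))
      (tensor_map (lmul mu (omega (bij_inv bij_alpha a))) beta r)); last first.
  apply: eq_tensor_map_comp => x /=.
    by rewrite /lmul alphaM -omegaE.
  by rewrite /rmul betaM -psiE.
(* It remains to see that [X - Y - Z = (X - M - W) + (M - Y - Z) + W], with [M] the mixed term and
   [W] the weight. *)
by rewrite [RHS]addrAC subrK !addrA subrK.
Qed.

End TildeDelta.

Theorem proposition3p13 (K : fieldType) (lambda : K) (A : lmodType K)
    (mu : {linear (A \otimes A)%type -> A}) (one : A)
    (alpha beta psi omega : {linear A -> A})
    (hA : unitary_bihom_associative mu one alpha beta)
    (bij_alpha : bijective alpha) (bij_beta : bijective beta)
    (alpha_psi : commuting alpha psi) (alpha_omega : commuting alpha omega)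
    (beta_psi : commuting beta psi) (beta_omega : commuting beta omega)
    (psi_omega : commuting psi omega)
    (psiM : multiplicative_for mu psi) (omegaM : multiplicative_for mu omega)
    (psi1 : psi one = one) (omega1 : omega one = one)
    (r : (A \otimes A)%type)
    (r_alpha : tensor_map alpha alpha r = r)
    (r_beta : tensor_map beta beta r = r)
    (r_psi : tensor_map psi psi r = r)
    (r_omega : tensor_map omega omega r = r) :
  bihom_derivation mu lambda alpha beta psi omega
    (tilde_Delta mu lambda one psi omega bij_alpha bij_beta r).
Proof.
have [[ab alphaM betaM _] alpha1 beta1 _ _] := hA.
have flip f g : commuting f g -> commuting g f by move=> fg x; rewrite fg.
split.
- exact: tilde_Delta_linear.
- by apply: tilde_Delta_equivariant => //; exact: flip.
- by apply: tilde_Delta_equivariant => //; exact: flip.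
- by apply: tilde_Delta_equivariant => //; exact: flip.
- exact: tilde_Delta_equivariant.
- exact: tilde_Delta_Leibniz.
Qed.
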